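(* Let $\mathbf{k}$ be a field, $X$ a set and $\Phi\subseteq \mathbf{k}\mathfrak{M}(X)$ a system of operated polynomial identities (OPIs). Then: (1) For any set $Z$ and any monomial order $\leq$ on $\mathfrak{M}(Z)$, $\Phi$ is Gröbner-Shirshov on $Z$ with respect to $\leq$ if and only if $\Phi$ is convergent on $Z$ with respect to the orientation $\overline{S}_\Phi(Z):=\{\overline{\phi(\mathfrak{u})}\mid \phi(\mathfrak{u})\in S_\Phi(Z)\}$ from $\leq$ (i.e. each element of $S_\Phi(Z)$ is oriented by its leading monomial with respect to $\leq$). (2) If $\Phi$ is Gröbner-Shirshov, then $\Phi$ is convergent. (3) If $\Phi$ is potentially Gröbner-Shirshov, then $\Phi$ is potentially convergent.
   Context: **Bracketed words.** For a set $Z$, $M(Z)$ denotes the free monoid on $Z$. Put $\mathfrak{M}_0(Z)=M(Z)$ and $\mathfrak{M}_n(Z)=M(Z\cup\lfloor \mathfrak{M}_{n-1}(Z)\rfloor)$ for $n\ge1$, where $\lfloor Y\rfloor=\{\lfloor u\rfloor\mid u\in Y\}$ is a disjoint copy of $Y$; with the natural embeddings, $\mathfrak{M}(Z)=\bigcup_n\mathfrak{M}_n(Z)$. Elements are called bracketed words (or monomials); $\mathfrak{M}(Z)$ is the free monoid with a self-map $u\mapsto\lfloor u\rfloor$ on $Z$, and $\mathbf{k}\mathfrak{M}(Z)$ (the $\mathbf{k}$-span, with the operator $\lfloor\ \rfloor$ extended linearly) is the free operated algebra on $Z$, an operated algebra being an associative unitary $\mathbf{k}$-algebra with a $\mathbf{k}$-linear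 self-map. Every $1\ne u\in\mathfrak{M}(Z)$ is uniquely a product $u_1\cdots u_n$ with $n\ge1$ and $u_i\in Z\cup\lfloor\mathfrak{M}(Z)\rfloor$; $|u|:=n$ is its breadth, and $|1|:=0$. $\mathfrak{M}^\star(Z)$ is the set of bracketed words on $Z\cup\{\star\}$ ($\star\notin Z$) containing $\star$ exactly once; for $q\in\mathfrak{M}^\star(Z)$, $q|_u$ is obtained by replacing $\star$ by $u\in\mathfrak{M}(Z)$, and $q|_s=\sum_i c_i q|_{u_i}$ for $s=\sum_i c_iu_i\in\mathbf{k}\mathfrak{M}(Z)$. For $S\subseteq\mathbf{k}\mathfrak{M}(Z)$, $\mathrm{Id}(S)$ is the operated ideal (two-sided ideal closed under $\lfloor\ \rfloor$) generated by $S$. **OPIs.** An OPI is an element $\phi=\phi(x_1,\dots,x_k)\in\mathbf{k}\mathfrak{M}(X)$, $k\ge 1$, $x_i\in X$. For $\mathfrak{u}=(u_1,\dots,u_k)\in\mathfrak{M}(Z)^k$, $\phi(\mathfrak{u})\in\mathbf{k}\mathfrak{M}(Z)$ is obtained by substituting $u_i$ for $x_i$ (the image under the operated algebra morphism $x_i\mapsto u_i$). For $\Phi\subseteq\mathbf{k}\mathfrak{M}(X)$, $S_\Phi(Z)=\{\phi(u_1,\dots,u_k)\mid u_i\in\mathfrak{M}(Z),\ \phi\in\Phi\}$; zero elements of this set are disregarded. **Rewriting systems.** Let $V$ be a $\mathbf{k}$-space with basis $W$. For $f\in V$, $\mathrm{Supp}(f)$ is the set of basis elements with nonzero coefficient in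 $f$. A term-rewriting system is a subset $\Pi\subseteq W\times V$, with elements written $t\to v$. If $f=ct+f_1$ with $0\ne c\in\mathbf{k}$, $t\notin\mathrm{Supp}(f_1)$ and $t\to v\in\Pi$, then $f\to_\Pi cv+f_1$ is a one-step rewriting. $\Pi$ is terminating if there is no infinite chain of one-step rewritings; confluent if, with $\overset{*}{\to}_\Pi$ the reflexive-transitive closure, whenever $f\overset{*}{\to}_\Pi g$ and $f\overset{*}{\to}_\Pi h$ there is $e$ with $g\overset{*}{\to}_\Pi e$ and $h\overset{*}{\to}_\Pi e$; convergent if both. **Convergent OPIs.** An orientation of a set $S\subseteq\mathbf{k}\mathfrak{M}(Z)$ of nonzero elements is a choice, for each $s\in S$, of a monomial $\widetilde{s}\in\mathrm{Supp}(s)$; dividing $s$ by the coefficient of $\widetilde{s}$, write $s=\widetilde{s}-R(s)$ with $\widetilde s\notin\mathrm{Supp}(R(s))$. The associated system on $V=\mathbf{k}\mathfrak{M}(Z)$, $W=\mathfrak{M}(Z)$, is $\Pi_{S,\widetilde S}=\{q|_{\widetilde s}\to q|_{R(s)}\mid s\in S,\ q\in\mathfrak{M}^\star(Z)\}$. $\Phi$ is convergent on $Z$ with respect to an orientation $\widetilde{S}_\Phi(Z)$ of $S_\Phi(Z)$ if $\Pi_{S_\Phi(Z),\widetilde{S}_\Phi(Z)}$ is convergent. $\Phi$ is potentially convergent on $Z$ with respect to $\widetilde{S}_\Phi(Z)$ if there are $\Phi'$ with $\Phi\subseteq\Phi'\subseteq\mathbf{k}\mathfrak{M}(X)$ and $\mathrm{Id}(S_\Phi(Z))=\mathrm{Id}(S_{\Phi'}(Z))$,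 and an orientation of $S_{\Phi'}(Z)$ extending $\widetilde{S}_\Phi(Z)$, whose associated rewriting system is convergent. $\Phi$ is convergent (resp. potentially convergent) if for each set $Z$ there is an orientation $\widetilde{S}_\Phi(Z)$ such that $\Phi$ is convergent (resp. potentially convergent) on $Z$ with respect to $\widetilde{S}_\Phi(Z)$. **Gröbner-Shirshov OPIs.** A monomial order on $\mathfrak{M}(Z)$ is a well-order $\leq$ such that $u<v$ implies $q|_u<q|_v$ for all $q\in\mathfrak{M}^\star(Z)$. The leading monomial $\overline f$ of $f\ne0$ is its largest monomial; $f$ is monic if the coefficient of $\overline f$ is $1$. For monic $f,g$: if $w=\overline f u=v\overline g$ with $w,u,v\in\mathfrak{M}(Z)$ and $\max\{|\overline f|,|\overline g|\}<|w|<|\overline f|+|\overline g|$, then $fu-vg$ is an intersection composition with respect to $w$; if $w=\overline f=q|_{\overline g}$ with $q\in\mathfrak{M}^\star(Z)$, then $f-q|_g$ is an including composition with respect to $w$. An element is trivial modulo $(S,w)$ if it equals a finite sum $\sum_ic_iq_i|_{s_i}$ with $c_i\in\mathbf{k}$, $q_i\in\mathfrak{M}^\star(Z)$, $s_i\in S$, $q_i|_{\overline{s_i}}<w$ ($0$ is always trivial). $S$ is a Gröbner-Shirshov basis with respect to $\leq$ if, after making its elements monic, all intersection and including compositions of pairs $f,g\in S$ with respect to any $w$ are trivial modulo $(S,w)$. $\Phi$ is Gröbner-Shirshov on $Z$ with respect to $\leq$ if $S_\Phi(Z)$ is a Gröbner-Shirshov basis in $\mathbf{k}\mathfrak{M}(Z)$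 with respect to $\leq$; it is potentially Gröbner-Shirshov on $Z$ with respect to $\leq$ if some $\Phi'$ with $\Phi\subseteq\Phi'\subseteq\mathbf{k}\mathfrak{M}(X)$ and $\mathrm{Id}(S_\Phi(Z))=\mathrm{Id}(S_{\Phi'}(Z))$ is Gröbner-Shirshov on $Z$ with respect to $\leq$. $\Phi$ is Gröbner-Shirshov (resp. potentially Gröbner-Shirshov) if for each set $Z$ there is a monomial order $\leq$ on $\mathfrak{M}(Z)$ such that $\Phi$ is Gröbner-Shirshov (resp. potentially Gröbner-Shirshov) on $Z$ with respect to $\leq$. *)

(* Defs.v *)
From HB Require Import structures.
From mathcomp Require Import all_boot all_algebra.
From mathcomp Require Import finmap.
From mathcomp Require Import boolp classical_sets wochoice.
From mathcomp.multinomials Require Import monalg.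
From Stdlib Require Import Relation_Operators.

Set Implicit Arguments.
Unset Strict Implicit.
Unset Printing Implicit Defensive.

Import GRing.Theory.

Local Open Scope classical_set_scope.
Local Open Scope ring_scope.

(* [bword Z] is the least fixpoint of [Y |-> M(Z + Y)], that is, the union of
   the chain of free monoids over [Z] and bracketed words of smaller depth. *)
Inductive bletter (Z : Type) : Type :=
  | bvar of Z
  | bbrack of seq (bletter Z).

Definition bword (Z : Type) : Type := seq (bletter Z).

(* [Z] is an arbitrary type: decidable equality and choice are classical. *)
HB.instance Definition _ (Z : Type) := gen_eqMixin (bletter Z).
HB.instance Definition _ (Z : Type) := gen_choiceMixin (bletter Z).
HB.instance Definition _ (Z : Type) := Choice.copy (bword Z) (seq (bletter Z)).

Lemma bword_unitm (Z : Type) (u v : bword Z) :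
  u ++ v = [::] -> u = [::] /\ v = [::].
Proof. by case: u. Qed.

HB.instance Definition _ (Z : Type) :=
  Choice_isMonomialDef.Build (bword Z)
    (@catA (bletter Z)) (@cat0s (bletter Z)) (@cats0 (bletter Z))
    (@bword_unitm Z).

Definition bvarw (Z : Type) (z : Z) : bword Z := [:: bvar z].
Definition bbrackw (Z : Type) (u : bword Z) : bword Z := [:: bbrack u].
Definition breadth (Z : Type) (u : bword Z) : nat := size u.

Fixpoint bsubst_letter (Y Z : Type) (h : Y -> bword Z) (a : bletter Y) :
    bword Z :=
  match a with
  | bvar y => h y
  | bbrack u => bbrackw (flatten (map (bsubst_letter h) u))
  end.

Definition bsubst (Y Z : Type) (h : Y -> bword Z) (u : bword Y) : bword Z :=
  flatten (map (bsubst_letter h) u).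

(* The symbol [star], not in [Z], is [None : option Z]. *)

Fixpoint count_star_letter (Z : Type) (a : bletter (option Z)) : nat :=
  match a with
  | bvar None => 1
  | bvar (Some _) => 0
  | bbrack u => sumn (map (@count_star_letter Z) u)
  end.

Definition count_star (Z : Type) (u : bword (option Z)) : nat :=
  sumn (map (@count_star_letter Z) u).

Definition starword (Z : Type) : Type :=
  {q : bword (option Z) | count_star q == 1%N}.

Definition plug (Z : Type) (q : starword Z) (u : bword Z) : bword Z :=
  bsubst (fun o => if o is Some z then bvarw z else u) (val q).

Notation opalg k Z := {malg k[bword Z]}.

Definition linext (k : fieldType) (Y Z : Type) (h : bword Y -> bword Z)
    (f : opalg k Y) : opalg k Z :=
  \sum_(u <- msupp f) << f@_u *g h u >>.

Definition pbrack (k : fieldType) (Z : Type) (f : opalg k Z) : opalg k Z :=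
  linext (@bbrackw Z) f.

Definition pplug (k : fieldType) (Z : Type) (q : starword Z) (f : opalg k Z) :
    opalg k Z :=
  linext (plug q) f.

(* The operated algebra morphism sending [x] to the monomial [h x]. *)
Definition psubst (k : fieldType) (X Z : Type) (h : X -> bword Z)
    (f : opalg k X) : opalg k Z :=
  linext (bsubst h) f.

Definition operated_ideal (k : fieldType) (Z : Type) (I : set (opalg k Z)) :
    Prop :=
  [/\ I 0,
      forall f g, I f -> I g -> I (f + g),
      forall (c : k) f, I f -> I (c *: f),
      forall a f, I f -> I (a * f) /\ I (f * a) &
      forall f, I f -> I (pbrack f)].

Definition Id (k : fieldType) (Z : Type) (S : set (opalg k Z)) :
    set (opalg k Z) :=
  smallest (@operated_ideal k Z) S.

(* An identity involves finitely many variables, so tuples of words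
   substituted for them are restrictions of assignments on all of [X]. *)
Definition instances (k : fieldType) (X : Type) (Phi : set (opalg k X))
    (Z : Type) : set (opalg k Z) :=
  [set s | s != 0 /\
     exists (phi : opalg k X) (h : X -> bword Z), Phi phi /\ s = psubst h phi].
Arguments instances {k X} Phi Z _.

Definition rewsys (k : fieldType) (W : choiceType) : Type :=
  W -> {malg k[W]} -> Prop.

Definition rewstep (k : fieldType) (W : choiceType) (Pi : rewsys k W)
    (f g : {malg k[W]}) : Prop :=
  exists (c : k) (t : W) (f1 v : {malg k[W]}),
    [/\ c != 0, t \notin msupp f1, Pi t v,
        f = << c *g t >> + f1 & g = c *: v + f1].

Definition rewstar (k : fieldType) (W : choiceType) (Pi : rewsys k W) :
    {malg k[W]} -> {malg k[W]} -> Prop :=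
  clos_refl_trans _ (rewstep Pi).

Definition terminating (k : fieldType) (W : choiceType) (Pi : rewsys k W) :
    Prop :=
  ~ exists f : nat -> {malg k[W]}, forall n, rewstep Pi (f n) (f n.+1).

Definition confluent (k : fieldType) (W : choiceType) (Pi : rewsys k W) :
    Prop :=
  forall f g h, rewstar Pi f g -> rewstar Pi f h ->
    exists e, rewstar Pi g e /\ rewstar Pi h e.

Definition convergent_sys (k : fieldType) (W : choiceType) (Pi : rewsys k W) :
    Prop :=
  terminating Pi /\ confluent Pi.

(* Only the values of [o] on [S] matter. *)
Definition orientation (k : fieldType) (Z : Type) (S : set (opalg k Z))
    (o : opalg k Z -> bword Z) : Prop :=
  forall s, S s -> o s \in msupp s.

Definition remainder (k : fieldType) (Z : Type) (o : opalg k Z -> bword Z)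
    (s : opalg k Z) : opalg k Z :=
  << o s >> - (s@_(o s))^-1 *: s.

Definition oriented_sys (k : fieldType) (Z : Type) (S : set (opalg k Z))
    (o : opalg k Z -> bword Z) : rewsys k (bword Z) :=
  fun t v => exists (s : opalg k Z) (q : starword Z),
    [/\ S s, t = plug q (o s) & v = pplug q (remainder o s)].

Definition convergent_on (k : fieldType) (X : Type) (Phi : set (opalg k X))
    (Z : Type) (o : opalg k Z -> bword Z) : Prop :=
  orientation (instances Phi Z) o /\
  convergent_sys (oriented_sys (instances Phi Z) o).

Definition pot_convergent_on (k : fieldType) (X : Type)
    (Phi : set (opalg k X)) (Z : Type) (o : opalg k Z -> bword Z) : Prop :=
  orientation (instances Phi Z) o /\
  exists (Phi' : set (opalg k X)) (o' : opalg k Z -> bword Z),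
    [/\ Phi `<=` Phi',
        Id (instances Phi Z) = Id (instances Phi' Z),
        forall s, instances Phi Z s -> o' s = o s &
        convergent_on Phi' o'].

Definition convergent (k : fieldType) (X : Type) (Phi : set (opalg k X)) :
    Prop :=
  forall Z : Type, exists o : opalg k Z -> bword Z, convergent_on Phi o.

Definition pot_convergent (k : fieldType) (X : Type) (Phi : set (opalg k X)) :
    Prop :=
  forall Z : Type, exists o : opalg k Z -> bword Z, pot_convergent_on Phi o.

Definition strict (Z : Type) (le : rel (bword Z)) : rel (bword Z) :=
  fun u v => (u != v) && le u v.

Definition monomial_order (Z : Type) (le : rel (bword Z)) : Prop :=
  well_order le /\
  forall (u v : bword Z), strict le u v ->
    forall q : starword Z, strict le (plug q u) (plug q v).

(* [xget] picks the largest monomial of [f]; for [f = 0] it returns [::]. *)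
Definition lead (k : fieldType) (Z : Type) (le : rel (bword Z))
    (f : opalg k Z) : bword Z :=
  xget [::] [set u | maximum_of le (mem (msupp f)) u].

Definition monicize (k : fieldType) (Z : Type) (le : rel (bword Z))
    (f : opalg k Z) : opalg k Z :=
  (f@_(lead le f))^-1 *: f.

Definition intersection_composition (k : fieldType) (Z : Type)
    (le : rel (bword Z)) (f g : opalg k Z) (w : bword Z) (h : opalg k Z) :
    Prop :=
  exists u v : bword Z,
    [/\ w = lead le f ++ u, w = v ++ lead le g,
        (maxn (breadth (lead le f)) (breadth (lead le g)) < breadth w)%N,
        (breadth w < breadth (lead le f) + breadth (lead le g))%N &
        h = f * << u >> - << v >> * g].

Definition including_composition (k : fieldType) (Z : Type)
    (le : rel (bword Z)) (f g : opalg k Z) (w : bword Z) (h : opalg k Z) :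
    Prop :=
  exists q : starword Z,
    [/\ w = lead le f, w = plug q (lead le g) & h = f - pplug q g].

Definition trivial_mod (k : fieldType) (Z : Type) (le : rel (bword Z))
    (S : set (opalg k Z)) (w : bword Z) (h : opalg k Z) : Prop :=
  exists (n : nat) (c : 'I_n -> k) (q : 'I_n -> starword Z)
         (s : 'I_n -> opalg k Z),
    (forall i, S (s i) /\ strict le (plug (q i) (lead le (s i))) w) /\
    h = \sum_(i < n) c i *: pplug (q i) (s i).

Definition GS_basis (k : fieldType) (Z : Type) (le : rel (bword Z))
    (S : set (opalg k Z)) : Prop :=
  let S1 := [set monicize le s | s in S] in
  forall (f g : opalg k Z) (w : bword Z) (h : opalg k Z), S1 f -> S1 g ->
    intersection_composition le f g w h \/ including_composition le f g w h ->
    trivial_mod le S1 w h.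

Definition GS_on (k : fieldType) (X : Type) (Phi : set (opalg k X))
    (Z : Type) (le : rel (bword Z)) : Prop :=
  GS_basis le (instances Phi Z).

Definition pot_GS_on (k : fieldType) (X : Type) (Phi : set (opalg k X))
    (Z : Type) (le : rel (bword Z)) : Prop :=
  exists Phi' : set (opalg k X),
    [/\ Phi `<=` Phi',
        Id (instances Phi Z) = Id (instances Phi' Z) &
        GS_on Phi' le].

Definition GS (k : fieldType) (X : Type) (Phi : set (opalg k X)) : Prop :=
  forall Z : Type, exists le : rel (bword Z),
    monomial_order le /\ GS_on Phi le.

Definition pot_GS (k : fieldType) (X : Type) (Phi : set (opalg k X)) : Prop :=
  forall Z : Type, exists le : rel (bword Z),
    monomial_order le /\ pot_GS_on Phi le.

(* Main.v *)
(* A one-step rewriting changes an element by a multiple of q|_s, and lowers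
   monomials strictly, so the system is terminating.  If two rules rewrite the
   same word w, confluence says that the difference of the results, which is a
   composition, is a combination of terms q|_s with q|_{lead s} < w.
   Conversely, two occurrences of leading words in w are disjoint, nested or
   overlapping; disjoint ones are always congruent below w, and the other two
   cases are the compositions.  If these are all trivial, any nonzero
   combination of terms q|_s has a reducible monomial (composition-diamond
   lemma), which applied to the difference of two normal forms of the same
   element shows that they are equal. *)

Require Import Defs.
From mathcomp Require Import all_boot all_algebra.
From mathcomp Require Import finmap.
From mathcomp Require Import boolp classical_sets wochoice.
From mathcomp.multinomials Require Import monalg.
From Stdlib Require Import Relation_Operators.

Set Implicit Arguments.
Unset Strict Implicit.
Unset Printing Implicit Defensive.

Import GRing.Theory.
Local Open Scope ring_scope.

(** * Factorizations of words and structural induction *)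

Lemma cat_eq_cat (T : Type) (s1 t1 s2 t2 : seq T) :
  s1 ++ t1 = s2 ++ t2 ->
  (exists m, s2 = s1 ++ m /\ t1 = m ++ t2) \/
  (exists m, s1 = s2 ++ m /\ t2 = m ++ t1).
Proof.
elim: s1 s2 => [|x s1 IH] [|y s2] /=.
- by move=> ->; left; exists [::].
- by move=> ->; left; exists (y :: s2).
- by move=> <-; right; exists (x :: s1).
- by case=> -> /IH [[m [-> ->]]|[m [-> ->]]]; [left|right]; exists m.
Qed.

(** Words nest inside their own letters, so the induction is a [fix] over letters with an inner
    induction over the word under each bracket. *)
Lemma bword_ind (Z : Type) (P : bword Z -> Prop) :
  P [::] -> (forall z u, P u -> P (bvar z :: u)) ->
  (forall v u, P v -> P u -> P (bbrack v :: u)) -> forall u, P u.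
Proof.
move=> P0 Pv Pb.
have Pl : forall a u, P u -> P (a :: u).
  fix IH 1 => -[z|v] u Pu; first exact: Pv.
  apply: Pb => //.
  by elim: v => [|a v IHv]; [exact: P0|exact: IH].
by elim => [|a u IHu]; [exact: P0|exact: Pl].
Qed.

(** * One-hole contexts and the relative position of two occurrences *)

Section Contexts.
Variable Z : Type.
Implicit Types (a b u v w : bword Z).

(** A word with one star, presented by the path of brackets leading to the star; two occurrences can
    then be compared by recursion on their paths. *)
Inductive ctx : Type :=
  | ctx_here of bword Z & bword Z
  | ctx_in of bword Z & ctx & bword Z.

Fixpoint fill (c : ctx) (u : bword Z) : bword Z :=
  match c with
  | ctx_here a b => a ++ u ++ b
  | ctx_in a d b => a ++ bbrack (fill d u) :: b
  end.

Fixpoint ctx_comp (c d : ctx) : ctx :=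
  match c, d with
  | ctx_here a b, ctx_here a' b' => ctx_here (a ++ a') (b' ++ b)
  | ctx_here a b, ctx_in a' d' b' => ctx_in (a ++ a') d' (b' ++ b)
  | ctx_in a c' b, _ => ctx_in a (ctx_comp c' d) b
  end.

Lemma fill_comp c d u : fill (ctx_comp c d) u = fill c (fill d u).
Proof.
elim: c => [a b|a c IH b] /=; last by rewrite IH.
by case: d => [a' b'|a' d b'] /=; rewrite -?catA.
Qed.

Lemma bsubst_cat (Y Y' : Type) (h : Y -> bword Y') (u v : bword Y) :
  bsubst h (u ++ v) = bsubst h u ++ bsubst h v.
Proof. by rewrite /bsubst map_cat flatten_cat. Qed.

Lemma bsubst_brack (Y Y' : Type) (h : Y -> bword Y') (v u : bword Y) :
  bsubst h (bbrack v :: u) = bbrack (bsubst h v) :: bsubst h u.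
Proof. by []. Qed.

Let star_subst (u : bword Z) (o : option Z) : bword Z :=
  if o is Some z then bvarw z else u.

(** The two halves are proved together: at a bracket the single star is either inside it or to its
    right, and the other part is then constant. *)
Lemma starless_or_ctx (q : bword (option Z)) :
  (count_star q = 0%N -> exists w, forall u, bsubst (star_subst u) q = w) /\
  (count_star q = 1%N -> exists c, forall u, bsubst (star_subst u) q = fill c u).
Proof.
elim/bword_ind: q => [|[z|] q [IH0 IH1]|p q [IHp0 IHp1] [IHq0 IHq1]].
- by split=> // _; exists [::].
- split=> [/IH0 [w e]|/IH1 [c e]].
    by exists (bvar z :: w) => u; rewrite -(e u).
  exists (ctx_comp (ctx_here [:: bvar z] [::]) c) => u.
  by rewrite fill_comp /= -e cats0.
- split=> [//|[/IH0 [w e]]].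
  by exists (ctx_here [::] w) => u; rewrite /= -(e u).
- have -> : count_star (bbrack p :: q) = (count_star p + count_star q)%N by [].
  split.
    move/eqP; rewrite addn_eq0 => /andP [/eqP /IHp0 [w1 e1] /eqP /IHq0 [w2 e2]].
    by exists (bbrack w1 :: w2) => u; rewrite bsubst_brack e1 e2.
  case Ep: (count_star p) => [|[|//]]; rewrite ?addSn ?add0n.
    move=> /IHq1 [c e2]; have [w e1] := IHp0 Ep.
    exists (ctx_comp (ctx_here [:: bbrack w] [::]) c) => u.
    by rewrite fill_comp bsubst_brack e1 e2 /= cats0.
  case=> /IHq0 [w e2]; have [c e1] := IHp1 Ep.
  by exists (ctx_in [::] c w) => u; rewrite bsubst_brack e1 e2.
Qed.

Lemma plug_fill (q : starword Z) : exists c, plug q =1 fill c.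
Proof.
case: q => q /= q1; have [c e] := proj2 (starless_or_ctx q) (eqP q1).
by exists c.
Qed.

Definition no_star : bword Z -> bword (option Z) :=
  bsubst (fun z => bvarw (Some z)).

Lemma count_star_cat (p q : bword (option Z)) :
  count_star (p ++ q) = (count_star p + count_star q)%N.
Proof. by rewrite /count_star map_cat sumn_cat. Qed.

Lemma count_no_star u : count_star (no_star u) = 0%N.
Proof.
elim/bword_ind: u => // v u IHv IHu.
by rewrite /no_star bsubst_brack /count_star /= -!/(count_star _) IHv IHu.
Qed.

Lemma bsubst_no_star u v : bsubst (star_subst u) (no_star v) = v.
Proof.
elim/bword_ind: v => // [z v IH|v1 v2 IH1 IH2].
  by rewrite -[RHS]/([:: bvar z] ++ v) -{2}IH.
by rewrite /no_star !bsubst_brack IH1 IH2.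
Qed.

(** The way back from contexts to starwords, so that both describe the same substitutions. *)
Fixpoint ctx_word (c : ctx) : bword (option Z) :=
  match c with
  | ctx_here a b => no_star a ++ bvar None :: no_star b
  | ctx_in a d b => no_star a ++ bbrack (ctx_word d) :: no_star b
  end.

Lemma count_ctx_word c : count_star (ctx_word c) == 1%N.
Proof.
apply/eqP; elim: c => [a b|a c IH b] /=; rewrite count_star_cat count_no_star.
  by rewrite /count_star /= -/(count_star _) count_no_star.
by rewrite /count_star /= -!/(count_star _) count_no_star IH.
Qed.

Definition ctx_star (c : ctx) : starword Z := Sub (ctx_word c) (count_ctx_word c).

Lemma plug_ctx_star c : plug (ctx_star c) =1 fill c.
Proof.
move=> u; rewrite /plug SubK -/(star_subst u).
elim: c => [a b|a c IH b] /=; rewrite bsubst_cat bsubst_no_star.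
  by rewrite -cat1s bsubst_cat bsubst_no_star {1}/bsubst /= cats0.
by rewrite bsubst_brack IH bsubst_no_star.
Qed.

(* Up to exchanging the two occurrences, these are the relative positions of an
   occurrence of [u] at [c] and an occurrence of [v] at [d] in the same word. *)
Variant placement (c : ctx) (u : bword Z) (d : ctx) (v : bword Z) : Prop :=
  | PlaceDisjoint (D : bword Z -> bword Z -> bword Z) of
      (forall y, exists e, D^~ y =1 fill e) & (forall x, exists e, D x =1 fill e)
      & fill c =1 D^~ v & fill d =1 D u
  | PlaceNested e of u = fill e v & fill d =1 fill (ctx_comp c e)
  | PlaceOverlap e p r s of p <> [::] & r <> [::] & s <> [::]
      & u = p ++ r & v = r ++ s
      & (forall x, fill c x = fill e (x ++ s))
      & (forall x, fill d x = fill e (p ++ x)).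

Definition placement_sym c u d v := placement c u d v \/ placement d v c u.

Lemma placement_in a b c u d v :
  placement c u d v -> placement (ctx_in a c b) u (ctx_in a d b) v.
Proof.
case=> [D D1 D2 Dc Dd|e eu ed|e p r s p0 r0 s0 eu ev ec ed].
- apply: (PlaceDisjoint (D := fun x y => a ++ bbrack (D x y) :: b)) => /=.
  + by move=> y; have [e eD] := D1 y; exists (ctx_in a e b) => x /=; rewrite eD.
  + by move=> x; have [e eD] := D2 x; exists (ctx_in a e b) => y /=; rewrite eD.
  + by move=> x; rewrite Dc.
  + by move=> x; rewrite Dd.
- by apply: (PlaceNested (e := e)) => // x /=; rewrite ed.
- by apply: (PlaceOverlap (e := ctx_in a e b) p0 r0 s0) => // x /=; rewrite ?ec ?ed.
Qed.

(** The word [m] separates the starts of the two occurrences. Comparing the end of [u] with the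
    start of [v], then the two ends, settles every case. *)
Lemma placement_here_here a m b u b' v :
  u ++ b = m ++ v ++ b' ->
  placement_sym (ctx_here a b) u (ctx_here (a ++ m) b') v.
Proof.
have disj t : placement (ctx_here a (t ++ v ++ b')) u
                        (ctx_here (a ++ u ++ t) b') v.
  apply: (PlaceDisjoint (D := fun x y => a ++ x ++ t ++ y ++ b')).
  + by move=> y; exists (ctx_here a (t ++ y ++ b')).
  + by move=> x; exists (ctx_here (a ++ x ++ t) b') => y /=; rewrite -?catA.
  + by [].
  + by move=> y /=; rewrite -?catA.
move=> /cat_eq_cat [[t [-> ->]]|[t [eu]]]; first by left; apply: disj.
move=> /cat_eq_cat [[s [et ->]]|[s [ev eb]]]; last first.
  (* Now u = m t and v = t s. An empty [t] makes the occurrences adjacent, hence disjoint; an empty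
     [m] or [s] nests one in the other; otherwise they properly overlap. *)
  case: t eu ev => [|l t] eu ev.
    left; rewrite cats0 in eu; rewrite -eu eb ev.
    by have := disj [::]; rewrite cats0 ev.
  case: m eu => [|l' m] eu.
    right; apply: (PlaceNested (e := ctx_here [::] s)); first by rewrite ev eu.
    by move=> x; rewrite /= !cats0 eb -?catA.
  case: s ev eb => [|l'' s] ev eb.
    left; apply: (PlaceNested (e := ctx_here (l' :: m) [::])).
      by rewrite eu ev /= !cats0.
    by move=> x; rewrite /= eb -?catA.
  left; apply: (PlaceOverlap (e := ctx_here a b') (p := l' :: m) (r := l :: t)
                              (s := l'' :: s)) => // x /=.
    by rewrite eb -?catA.
  by rewrite -?catA.
left; apply: (PlaceNested (e := ctx_here m s)); first by rewrite eu et.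
by move=> x; rewrite /= -?catA.
Qed.

(** The bracket around the second occurrence is a single letter of the outer word, so it lies either
    inside [u] (nested) or outside it (disjoint); a proper overlap cannot arise. *)
Lemma placement_here_in a b u a' d b' v :
  fill (ctx_here a b) u = fill (ctx_in a' d b') v ->
  placement_sym (ctx_here a b) u (ctx_in a' d b') v.
Proof.
move=> /= E; left; move: E.
have disj1 t : placement (ctx_here a (t ++ bbrack (fill d v) :: b')) u
                         (ctx_in (a ++ u ++ t) d b') v.
  apply: (PlaceDisjoint (D := fun x y => a ++ x ++ t ++ bbrack (fill d y) :: b')).
  + by move=> y; exists (ctx_here a (t ++ bbrack (fill d y) :: b')).
  + by move=> x; exists (ctx_in (a ++ x ++ t) d b') => y /=; rewrite -?catA.
  + by [].
  + by move=> y /=; rewrite -?catA.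
have disj2 m : placement (ctx_here (a' ++ bbrack (fill d v) :: m) b) u
                         (ctx_in a' d (m ++ u ++ b)) v.
  apply: (PlaceDisjoint (D := fun x y => a' ++ bbrack (fill d y) :: m ++ x ++ b)).
  + by move=> y; exists (ctx_here (a' ++ bbrack (fill d y) :: m) b) => x /=;
      rewrite -?catA.
  + by move=> x; exists (ctx_in a' d (m ++ x ++ b)).
  + by move=> x /=; rewrite -?catA.
  + by [].
have aux m : a' = a ++ m -> u ++ b = m ++ bbrack (fill d v) :: b' ->
    placement (ctx_here a b) u (ctx_in a' d b') v.
  move=> -> /cat_eq_cat [[t [-> ->]]|[[|l t] [eu]]]; first exact: disj1.
    by move=> /= <-; have := disj1 [::]; rewrite !cats0 in eu *; rewrite eu.
  case=> el ->; apply: (PlaceNested (e := ctx_in m d t)).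
    by rewrite eu -el.
  by move=> y.
case/cat_eq_cat => [[m []]|[[|l m] [ea]]]; first exact: aux.
  by rewrite /= => e; apply: (aux [::]); rewrite ?cats0 // ea cats0.
by case=> el ->; rewrite ea -el; apply: disj2.
Qed.

(** Descend while both paths enter the same bracket. Paths entering different brackets are disjoint,
    and the descent ends when one of the paths stops. *)
Lemma fill_placement c u d v : fill c u = fill d v -> placement_sym c u d v.
Proof.
elim: c d => [a b|a c IH b] [a' b'|a' d b'].
- move=> /= /cat_eq_cat [[m [-> e]]|[m [-> e]]].
    exact: placement_here_here.
  by case: (placement_here_here a' e) => p; [right|left].
- exact: placement_here_in.
- by move=> /esym /placement_here_in; case=> p; [right|left].
have disj (a0 : bword Z) (c0 : ctx) (m : bword Z) (d0 : ctx) (b0 u0 v0 : bword Z) :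
    placement (ctx_in a0 c0 (m ++ bbrack (fill d0 v0) :: b0)) u0
              (ctx_in (a0 ++ bbrack (fill c0 u0) :: m) d0 b0) v0.
  apply: (PlaceDisjoint (D := fun x y =>
    a0 ++ bbrack (fill c0 x) :: m ++ bbrack (fill d0 y) :: b0)).
  + by move=> y; exists (ctx_in a0 c0 (m ++ bbrack (fill d0 y) :: b0)).
  + by move=> x; exists (ctx_in (a0 ++ bbrack (fill c0 x) :: m) d0 b0) => y /=;
      rewrite -?catA.
  + by [].
  + by move=> y /=; rewrite -?catA.
have same : a' = a -> bbrack (fill c u) :: b = bbrack (fill d v) :: b' ->
    placement_sym (ctx_in a c b) u (ctx_in a' d b') v.
  move=> -> [/IH p <-].
  by case: p => /(placement_in a b) p; [left|right].
case/cat_eq_cat => [[[|l m] [ea]]|[[|l m] [ea]]].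
- by apply: same; rewrite ea cats0.
- by case=> el ->; rewrite ea -el; left; apply: disj.
- by move=> e; apply: same => //; rewrite ea cats0.
- by case=> el ->; rewrite ea -el; right; apply: disj.
Qed.

End Contexts.

(** * Elements whose monomials all satisfy a predicate *)

Section SuppIn.
Variables (k : fieldType) (W : choiceType).
Implicit Types (f g : {malg k[W]}) (P : W -> Prop) (u : W).

Definition supp_in P f := forall u, u \in msupp f -> P u.

Lemma supp_in0 P : supp_in P 0.
Proof. by move=> u; rewrite msupp0 in_fset0. Qed.

Lemma supp_inU P c u : P u -> supp_in P << c *g u >>.
Proof. by move=> Pu v /(fsubsetP msuppU_le); rewrite in_fset1 => /eqP ->. Qed.

Lemma supp_inD P f g : supp_in P f -> supp_in P g -> supp_in P (f + g).
Proof.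
by move=> Pf Pg u /(fsubsetP (msuppD_le _ _)); rewrite in_fsetU => /orP [/Pf|/Pg].
Qed.

Lemma supp_inZ P c f : supp_in P f -> supp_in P (c *: f).
Proof. by move=> Pf u /(fsubsetP (msuppZ_le _ _)) /Pf. Qed.

Lemma supp_inB P f g : supp_in P f -> supp_in P g -> supp_in P (f - g).
Proof. by move=> Pf Pg; rewrite -scaleN1r; apply: supp_inD => //; exact: supp_inZ. Qed.

Lemma supp_in_sum P (I : Type) (r : seq I) (Q : pred I) (F : I -> {malg k[W]}) :
  (forall i, Q i -> supp_in P (F i)) -> supp_in P (\sum_(i <- r | Q i) F i).
Proof. by move=> PF; elim/big_ind: _ => //; [exact: supp_in0|exact: supp_inD]. Qed.

Lemma malg_ind (P : {malg k[W]} -> Prop) :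
  P 0 -> (forall c u f, P f -> P (<< c *g u >> + f)) -> forall f, P f.
Proof.
move=> P0 PD f; rewrite (monalgE f).
by elim: (finmap.enum_fset _) => [|u r IH]; rewrite ?big_nil // big_cons; apply: PD.
Qed.

End SuppIn.

(** * Linear extension of maps between words *)

Section Linext.
Variables (k : fieldType) (Y Z : Type).
Implicit Types (h : bword Y -> bword Z) (f g : opalg k Y).

(** The sum defining [linext] ranges over a support that varies with [f]; as an instance of [mmap]
    it inherits additivity. *)
Lemma linextE h f : linext h f = mmap malgC (fun u => << h u >> : opalg k Z) f.
Proof.
rewrite mmapE; apply: eq_bigr => u _; rewrite mul_malgC.
by apply/malgP => v; rewrite mcoeffZ !mcoeffU mulrnAr mulr1.
Qed.

Lemma linext0 h : linext h 0 = 0 :> opalg k Z.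
Proof. by rewrite linextE mmap0. Qed.

Lemma linextU h c u : linext h << c *g u >> = << c *g h u >> :> opalg k Z.
Proof.
rewrite linextE mmapU mul_malgC.
by apply/malgP => v; rewrite mcoeffZ !mcoeffU mulrnAr mulr1.
Qed.

Lemma linextD h f g : linext h (f + g) = linext h f + linext h g.
Proof. by rewrite !linextE mmapD. Qed.

Lemma linextB h f g : linext h (f - g) = linext h f - linext h g.
Proof. by rewrite !linextE mmapB. Qed.

Lemma linextZ h c f : linext h (c *: f) = c *: linext h f.
Proof.
elim/malg_ind: f => [|d u f IH]; first by rewrite scaler0 !linext0 scaler0.
rewrite scalerDr !linextD IH scalerDr; congr (_ + _).
rewrite linextU -!mul_malgC !malgM_def !fgmulUU linextU.
by rewrite /= /mmul /=.
Qed.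

Lemma eq_linext h h' f : h =1 h' -> linext h f = linext h' f.
Proof. by move=> e; apply: eq_bigr => u _; rewrite e. Qed.

Lemma supp_in_linext (P : bword Z -> Prop) h f :
  supp_in (fun u => P (h u)) f -> supp_in P (linext h f).
Proof.
move=> Pf; rewrite /linext big_seq_cond; apply: supp_in_sum => u.
by rewrite andbT => /Pf; apply: supp_inU.
Qed.

End Linext.

Section LinextMore.
Variable k : fieldType.

Lemma linext_comp (Y Z T : Type) (h : bword Z -> bword T) (g : bword Y -> bword Z)
    (f : opalg k Y) :
  linext h (linext g f) = linext (fun u => h (g u)) f.
Proof.
elim/malg_ind: f => [|d u f IH]; first by rewrite !linext0.
by rewrite !linextD IH !linextU.
Qed.

(** Turns the products in an intersection composition into linear extensions, to be treated like
    contexts. *)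
Lemma malg_mulgU (Z : Type) (u : bword Z) (f : opalg k Z) :
  f * << u >> = linext (cat^~ u) f.
Proof.
by rewrite malgM_def fgmulgU; apply: eq_bigr => v _; rewrite mulr1.
Qed.

Lemma malg_mulUg (Z : Type) (u : bword Z) (f : opalg k Z) :
  << u >> * f = linext (cat u) f.
Proof.
by rewrite malgM_def fgmulUg; apply: eq_bigr => v _; rewrite mul1r.
Qed.

(** Both sides are the bilinear extension of [D] at [(f, g)], summed in the two possible orders. *)
Lemma linext_exchange (Z : Type) (D : bword Z -> bword Z -> bword Z)
    (f g : opalg k Z) :
  \sum_(y <- msupp g) g@_y *: linext (D^~ y) f =
  \sum_(x <- msupp f) f@_x *: linext (D x) g.
Proof.
rewrite /linext.
under eq_bigr do rewrite scaler_sumr.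
rewrite exchange_big /=; apply: eq_bigr => x _.
rewrite scaler_sumr; apply: eq_bigr => y _.
by apply/malgP => v; rewrite !mcoeffZ !mcoeffU !mulrnAr mulrC.
Qed.

End LinextMore.

(** * Linear spans *)

Section Span.
Variables (k : fieldType) (V : lmodType k).
Implicit Types (G : V -> Prop).

(** Combinations are built one generator at a time, to allow induction; [lspanP] gives back the
    indexed sums of [trivial_mod]. *)
Inductive lspan G : V -> Prop :=
  | lspan0 : lspan G 0
  | lspan_cons c g f : G g -> lspan G f -> lspan G (c *: g + f).

Lemma lspanD G f g : lspan G f -> lspan G g -> lspan G (f + g).
Proof.
move=> Gf Gg; elim: Gf => [|c g' f' Gg' _ IH]; first by rewrite add0r.
by rewrite -addrA; apply: lspan_cons.
Qed.

Lemma lspanZ G c f : lspan G f -> lspan G (c *: f).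
Proof.
elim=> [|d g f' Gg _ IH]; first by rewrite scaler0; apply: lspan0.
by rewrite scalerDr scalerA; apply: lspan_cons.
Qed.

Lemma lspanB G f g : lspan G f -> lspan G g -> lspan G (f - g).
Proof. by move=> Gf Gg; rewrite -scaleN1r; apply: lspanD => //; exact: lspanZ. Qed.

Lemma lspan_gen G g : G g -> lspan G g.
Proof. by move=> Gg; rewrite -[g]addr0 -[g]scale1r; apply/lspan_cons/lspan0. Qed.

Lemma lspan_sum G (I : Type) (r : seq I) (Q : pred I) (F : I -> V) :
  (forall i, Q i -> lspan G (F i)) -> lspan G (\sum_(i <- r | Q i) F i).
Proof. by move=> PF; elim/big_ind: _ => //; [exact: lspan0|exact: lspanD]. Qed.

Lemma lspan_mono G G' f : (forall g, G g -> G' g) -> lspan G f -> lspan G' f.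
Proof.
move=> GG'; elim=> [|c g f' Gg _ IH]; first exact: lspan0.
by apply: lspan_cons => //; apply: GG'.
Qed.

Lemma lspanP G f : lspan G f <->
  exists (n : nat) (c : 'I_n -> k) (g : 'I_n -> V),
    (forall i, G (g i)) /\ f = \sum_(i < n) c i *: g i.
Proof.
split=> [|[n [c [g [Gg ->]]]]]; last first.
  by apply: lspan_sum => i _; apply/lspanZ/lspan_gen.
elim=> [|c g f' Gg _ [n [d [h [Gh ->]]]]].
  by exists 0%N, (fun=> 0), (fun=> 0); split=> [[]//|]; rewrite big_ord0.
exists n.+1, (fun i => oapp d c (unlift ord0 i)), (fun i => oapp h g (unlift ord0 i)).
split=> [i|]; first by case: unliftP => [j|] _ /=.
rewrite big_ord_recl unlift_none /=; congr (_ + _).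
by apply: eq_bigr => i _; rewrite liftK.
Qed.

End Span.

(** * Order axioms derived from minima *)

Section WellOrder.
Variables (T : choiceType) (le : rel T).
Hypothesis le_wo : well_order le.

(** [well_order] speaks only of unique minima of nonempty sets; the order axioms are read off from
    minima of sets of two or three elements. *)
Lemma wo_total : total le.
Proof.
move=> x y; have [|z [[zA lez] _]] := le_wo (A := pred2 x y); first by exists x; rewrite !inE eqxx.
have lx : le z x by apply: lez; rewrite !inE eqxx.
have ly : le z y by apply: lez; rewrite !inE eqxx orbT.
by move: zA; rewrite !inE => /orP [] /eqP <-; rewrite ?lx ?ly ?orbT.
Qed.

Lemma wo_refl : reflexive le.
Proof. by move=> x; have := wo_total x x; rewrite orbb. Qed.

(** Both [x] and [y] would be minima of the pair, and the minimum is unique. *)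
Lemma wo_anti x y : le x y -> le y x -> x = y.
Proof.
move=> xy yx; have [|z [_ zu]] := le_wo (A := pred2 x y).
  by exists x; rewrite !inE eqxx.
rewrite -(zu x) ?(zu y) //; split=> [|t]; rewrite !inE ?eqxx ?orbT //.
  by case/orP => /eqP -> //; apply: wo_refl.
by case/orP => /eqP -> //; apply: wo_refl.
Qed.

Lemma wo_trans : transitive le.
Proof.
move=> y x z xy yz; have [|t [[tA let_] _]] := le_wo (A := pred3 x y z).
  by exists x; rewrite !inE eqxx.
have lx : le t x by apply: let_; rewrite !inE eqxx.
have ly : le t y by apply: let_; rewrite !inE eqxx orbT.
have lz : le t z by apply: let_; rewrite !inE eqxx !orbT.
move: tA; rewrite !inE => /or3P [] /eqP et; subst t => //.
  by rewrite (wo_anti xy lx).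
by rewrite -(wo_anti yz ly).
Qed.

Lemma wo_seq_max (r : seq T) : r != [::] ->
  exists2 m, m \in r & forall x, x \in r -> le x m.
Proof.
elim: r => // x [|y r] IH _.
  by exists x; rewrite ?mem_head // => z; rewrite inE => /eqP ->; apply: wo_refl.
have [//|m mr max_m] := IH.
have [lexm|lemx] := orP (wo_total x m).
  exists m; first by rewrite inE mr orbT.
  by move=> z; rewrite inE => /predU1P [->|/max_m].
exists x; first exact: mem_head.
by move=> z; rewrite inE => /predU1P [->|/max_m zm]; [apply: wo_refl|apply: wo_trans lemx].
Qed.

End WellOrder.

(** * Leading monomials for a monomial order *)

Section Lead.
Variables (k : fieldType) (Z : Type) (le : rel (bword Z)).
Hypothesis le_mono : monomial_order le.
Local Notation lt := (strict le).
Implicit Types (f g : opalg k Z) (u v w : bword Z).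

Let le_wo : well_order le := proj1 le_mono.

Lemma lt_irr u : lt u u = false.
Proof. by rewrite /strict eqxx. Qed.

Lemma lt_le u v : lt u v -> le u v.
Proof. by case/andP. Qed.

Lemma le_eqVlt u v : le u v -> u = v \/ lt u v.
Proof. by rewrite /strict => ->; case: eqP; [left|right]. Qed.

Lemma le_lt_trans v u w : le u v -> lt v w -> lt u w.
Proof.
move=> uv /andP [vw lvw]; rewrite /strict (wo_trans le_wo uv lvw) andbT.
by apply: contraNneq vw => e; subst u; apply/eqP; apply: (wo_anti le_wo lvw uv).
Qed.

Lemma lt_trans v u w : lt u v -> lt v w -> lt u w.
Proof. by move/lt_le; apply: le_lt_trans. Qed.

Lemma lt_fill c u v : lt u v -> lt (fill c u) (fill c v).
Proof.
by move=> /(proj2 le_mono _ _) /(_ (ctx_star c)); rewrite !plug_ctx_star.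
Qed.

(** The least non-accessible word would have only accessible predecessors. *)
Lemma lt_wf : well_founded (fun u v => lt u v).
Proof.
move=> u; apply: contrapT => nAu.
have [|z [[/asboolP nAz minz] _]] :=
    le_wo (A := fun x => `[< ~ Acc (fun u v => lt u v) x >]).
  by exists u; apply/asboolP.
apply: nAz; constructor => y yz; apply: contrapT => nAy.
have zy : le z y by apply: minz; apply/asboolP.
by have := le_lt_trans zy yz; rewrite lt_irr.
Qed.

Lemma leadP f : f != 0 ->
  lead le f \in msupp f /\ forall u, u \in msupp f -> le u (lead le f).
Proof.
move=> f0; rewrite /lead; case: xgetP => [u _ [uf maxu]|/= no_max].
  by split=> // v vf; apply: maxu.
have [|m mf max_m] := @wo_seq_max _ _ le_wo (finmap.enum_fset (msupp f)).
  apply: contraNneq f0 => e; rewrite -msupp_eq0; apply/eqP/fsetP => u.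
  by rewrite in_fset0 -[LHS]/(u \in finmap.enum_fset (msupp f)) e.
by have := no_max m; case; split=> // v vf; apply: max_m.
Qed.

Lemma leadZ c f : c != 0 -> lead le (c *: f) = lead le f.
Proof. by move=> c0; rewrite /lead msuppZ (negbTE c0). Qed.

Definition lead_monic f := f@_(lead le f) == 1.

Lemma monicize_monic f : f != 0 -> lead_monic (monicize le f).
Proof.
move=> f0; have [lf _] := leadP f0; rewrite -mcoeff_neq0 in lf.
by rewrite /lead_monic /monicize leadZ ?invr_neq0 // mcoeffZ mulVf.
Qed.

Lemma lead_monicize f : f != 0 -> lead le (monicize le f) = lead le f.
Proof.
move=> f0; have [lf _] := leadP f0; rewrite -mcoeff_neq0 in lf.
by rewrite /monicize leadZ // invr_neq0.
Qed.

(** The coefficient 1 makes the leading monomial cancel, so the right-hand side of a rule lies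
    strictly below its left-hand side. *)
Lemma monic_tail f : lead_monic f -> supp_in (lt^~ (lead le f)) (<< lead le f >> - f).
Proof.
move=> /eqP fm; have f0 : f != 0.
  by apply/eqP => e; move/eqP: fm; rewrite e mcoeff0 eq_sym oner_eq0.
have [_ maxf] := leadP f0.
move=> u; have [->|nu] := eqVneq u (lead le f).
  by rewrite -mcoeff_neq0 mcoeffB mcoeffUU fm subrr eqxx.
rewrite -mcoeff_neq0 mcoeffB mcoeffU [lead le f == u]eq_sym (negbTE nu) mulr0n add0r oppr_eq0.
by rewrite mcoeff_neq0 => /maxf lu; rewrite /strict nu.
Qed.

End Lead.

(** * Generators in context and the composition-diamond lemma *)

Section Diamond.
Variables (k : fieldType) (Z : Type) (le : rel (bword Z)).
Hypothesis le_mono : monomial_order le.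
Variable S : set (opalg k Z).
Hypothesis S_monic : forall s, S s -> lead_monic le s.
Local Notation lt := (strict le).
Implicit Types (f g h s : opalg k Z) (t u v w : bword Z) (c d : ctx Z).
Implicit Type P : bword Z -> Prop.

Let le_wo : well_order le := proj1 le_mono.

(** The terms q|_s whose top word q|_(lead s) satisfies [P]. Taking [P] to be strictly below [w]
    gives triviality modulo [w]. *)
Definition ctx_gen P h : Prop :=
  exists s c, [/\ S s, P (fill c (lead le s)) & h = linext (fill c) s].

Lemma trivial_modP w h : trivial_mod le S w h <-> lspan (ctx_gen (lt^~ w)) h.
Proof.
rewrite lspanP; split=> -[n [c]].
  move=> [q [s [Sq ->]]]; exists n, c, (fun i => pplug (q i) (s i)); split=> // i.
  have [Ss lts] := Sq i; have [d qd] := plug_fill (q i).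
  by exists (s i), d; rewrite -qd; split=> //; apply: eq_linext.
move=> [g [Gg ->]].
have /choice [s /choice [d sd]] := Gg.
exists n, c, (fun i => ctx_star (d i)), s; split=> [i|].
  by have [Ss lts _] := sd i; rewrite plug_ctx_star.
apply: eq_bigr => i _; have [_ _ ->] := sd i.
by congr (_ *: _); apply/eq_linext/fsym/plug_ctx_star.
Qed.

Lemma linext_fill_comp c d f :
  linext (fill c) (linext (fill d) f) = linext (fill (ctx_comp c d)) f.
Proof. by rewrite linext_comp; apply/eq_linext => u; rewrite fill_comp. Qed.

(** Contexts compose and preserve the strict order, so a composition trivial at its own word stays
    trivial inside any context. *)
Lemma lspan_fill c w h :
  lspan (ctx_gen (lt^~ w)) h ->
  lspan (ctx_gen (lt^~ (fill c w))) (linext (fill c) h).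
Proof.
elim=> [|a g f [s [d [Ss ltd ->]]] _ IH]; first by rewrite linext0; apply: lspan0.
rewrite linextD linextZ; apply: lspan_cons => //.
exists s, (ctx_comp c d); split=> //; first by rewrite fill_comp; apply: lt_fill.
exact: linext_fill_comp.
Qed.

Lemma lspan_subC P f g : lspan (ctx_gen P) (f - g) -> lspan (ctx_gen P) (g - f).
Proof. by move/(lspanZ (-1)); rewrite scaleN1r opprB. Qed.

(* Expand the bilinear extension of [D] at [(f, g)] in two ways, along the
   monomials of [g] and along those of [f]; the leading terms of the two
   expansions are the two sides of the difference, and all others lie below. *)
Lemma disjoint_congruent (D : bword Z -> bword Z -> bword Z) f g :
  (forall y, exists e, D^~ y =1 fill e) -> (forall x, exists e, D x =1 fill e) ->
  S f -> S g ->
  lspan (ctx_gen (lt^~ (D (lead le f) (lead le g))))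
    (linext (D^~ (lead le g)) f - linext (D (lead le f)) g).
Proof.
move=> D1 D2 Sf Sg.
have monic_neq0 s : S s -> s@_(lead le s) = 1 /\ s != 0.
  move=> /S_monic /eqP ms; split=> //.
  by apply/eqP => e; move/eqP: ms; rewrite e mcoeff0 eq_sym oner_eq0.
have [f1 f0] := monic_neq0 f Sf; have [g1 g0] := monic_neq0 g Sg.
have [lf maxf] := leadP le_mono f0; have [lg maxg] := leadP le_mono g0.
have := linext_exchange D f g.
rewrite (big_fsetD1 _ lg) (big_fsetD1 _ lf) /= f1 g1 !scale1r.
set A := \sum_(_ <- _) _; set B := \sum_(_ <- _) _ => AB.
have -> : linext (D^~ (lead le g)) f - linext (D (lead le f)) g = B - A.
  by apply/eqP; rewrite subr_eq -(inj_eq (addIr A)) AB addrAC subrK addrC.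
have D_ltl x y : lt x (lead le f) -> lt (D x y) (D (lead le f) y).
  by have [e De] := D1 y; move=> /(lt_fill le_mono e); rewrite -!De.
have D_ltr x y : lt y (lead le g) -> lt (D x y) (D x (lead le g)).
  by have [e De] := D2 x; move=> /(lt_fill le_mono e); rewrite -!De.
apply: lspanB; rewrite /A /B big_seq; apply: lspan_sum => x; rewrite in_fsetD1.
  move=> /andP [nx /maxf lx]; apply/lspanZ/lspan_gen.
  have [e De] := D2 x; exists g, e; split=> //; last exact: (eq_linext _ De).
  by rewrite -De; apply: D_ltl; rewrite /strict nx.
move=> /andP [nx /maxg lx]; apply/lspanZ/lspan_gen.
have [e De] := D1 x; exists f, e; split=> //; last exact: (eq_linext _ De).
by rewrite -De; apply: D_ltr; rewrite /strict nx.
Qed.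

Definition compositions_trivial : Prop :=
  forall f g w h, S f -> S g ->
    intersection_composition le f g w h \/ including_composition le f g w h ->
    trivial_mod le S w h.

(** A nested pair is a context around an including composition, an overlapping pair a context around
    an intersection composition; [lspan_fill] carries triviality outwards. Disjoint pairs fall under
    [disjoint_congruent]. *)
Lemma placement_congruent c d f g : compositions_trivial ->
  S f -> S g -> placement c (lead le f) d (lead le g) ->
  lspan (ctx_gen (lt^~ (fill c (lead le f))))
    (linext (fill c) f - linext (fill d) g).
Proof.
move=> triv Sf Sg [D D1 D2 Dc Dd|e ef ed|e p r s p0 r0 s0 ef eg ec ed].
- rewrite Dc (eq_linext _ Dc) (eq_linext _ Dd).
  exact: disjoint_congruent.
- rewrite (eq_linext _ ed).
  rewrite -(linext_fill_comp c e) -linextB.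
  apply: lspan_fill; apply/trivial_modP/(triv f g) => //; right.
  exists (ctx_star e); rewrite plug_ctx_star; split=> //.
  by congr (_ - _); apply/eq_linext/fsym/plug_ctx_star.
- have gt0 (q : bword Z) : q <> [::] -> (0 < size q)%N by case: q.
  have [[p_gt0 r_gt0] s_gt0] := (gt0 p p0, gt0 r r0, gt0 s s0).
  rewrite (eq_linext _ ec) (eq_linext _ ed) ec.
  rewrite -(linext_comp (fill e) (cat^~ s)) -(linext_comp (fill e) (cat p)) -linextB.
  apply: lspan_fill; apply/trivial_modP/(triv f g) => //; left.
  exists s, p; split=> //; last by rewrite malg_mulgU malg_mulUg.
  + by rewrite ef eg catA.
  (* For the word p r s the lower bound on breadth holds as [s] and [p] are nonempty, the upper
     bound as [r] is nonempty. *)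
  + rewrite /breadth eg ef !size_cat gtn_max -[X in (X < _)%N]addn0 ltn_add2l.
    by rewrite s_gt0 -addnA -[X in (X < _)%N]add0n ltn_add2r.
  + by rewrite /breadth eg ef !size_cat -!addnA !ltn_add2l -[X in (X < _)%N]add0n
      ltn_add2r.
Qed.

Lemma same_word_congruent c d f g : compositions_trivial ->
  S f -> S g -> fill c (lead le f) = fill d (lead le g) ->
  lspan (ctx_gen (lt^~ (fill c (lead le f))))
    (linext (fill c) f - linext (fill d) g).
Proof.
move=> triv Sf Sg e; case: (fill_placement e) => p; first exact: placement_congruent.
by rewrite e; apply/lspan_subC/placement_congruent.
Qed.

Lemma linext_fill_tail c s : S s ->
  supp_in (lt^~ (fill c (lead le s)))
    (<< fill c (lead le s) >> - linext (fill c) s).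
Proof.
move=> Ss; rewrite -linextU -linextB; apply: supp_in_linext => u us.
by apply: lt_fill => //; apply: (monic_tail le_mono (S_monic Ss)).
Qed.

Lemma supp_in_lspan P h : (forall u v, lt u v -> P v -> P u) ->
  lspan (ctx_gen P) h -> supp_in P h.
Proof.
move=> Pd; elim=> [|a g f [s [c [Ss Pc ->]]] _ IH]; first exact: supp_in0.
apply: supp_inD => //; apply: supp_inZ.
rewrite -[linext _ _](subKr << fill c (lead le s) >>).
apply: supp_inB; first exact: supp_inU.
by move=> u /(linext_fill_tail Ss) /Pd; apply.
Qed.

(** A combination is finite, so a largest top word serves as a bound; this starts the induction of
    [lspan_reducible] and makes it descend. *)
Lemma lspan_bound P h : lspan (ctx_gen P) h ->
  h = 0 \/ exists2 w, P w & lspan (ctx_gen (le^~ w)) h.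
Proof.
elim=> [|a g f [s [c [Ss Pc ->]]] _ IH]; first by left.
have gle w : le (fill c (lead le s)) w -> ctx_gen (le^~ w) (linext (fill c) s).
  by move=> lew; exists s, c.
right; case: IH => [->|[w Pw fw]].
  exists (fill c (lead le s)) => //; apply/lspan_cons/lspan0/gle.
  exact: wo_refl.
have [lw|lw] := orP (wo_total le_wo (fill c (lead le s)) w).
  by exists w => //; apply: lspan_cons => //; apply: gle.
exists (fill c (lead le s)) => //; apply: lspan_cons; first exact/gle/wo_refl.
apply: lspan_mono fw => _ [s' [c' [Ss' le' ->]]].
by exists s', c'; split=> //; apply: wo_trans lw.
Qed.

(** Generators with top word [w] are congruent to each other modulo terms below [w], so they merge
    into one multiple of a single generator. The coefficient [a] may vanish. *)
Lemma lspan_le_top w h : compositions_trivial -> lspan (ctx_gen (le^~ w)) h ->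
  lspan (ctx_gen (lt^~ w)) h \/
  exists a s c, [/\ S s, fill c (lead le s) = w &
    lspan (ctx_gen (lt^~ w)) (h - a *: linext (fill c) s)].
Proof.
move=> triv; elim=> [|a g f [s [c [Ss lew ->]]] _ IH]; first by left; apply: lspan0.
have [ew|ltw] := le_eqVlt lew; last first.
  have gs : ctx_gen (lt^~ w) (linext (fill c) s) by exists s, c.
  case: IH => [IH|[b [s' [c' [Ss' e' IH]]]]]; first by left; apply: lspan_cons.
  by right; exists b, s', c'; split=> //; rewrite -addrA; apply: lspan_cons.
right; case: IH => [IH|[b [s' [c' [Ss' e' IH]]]]].
  by exists a, s, c; split=> //; rewrite addrAC subrr add0r.
exists (a + b), s', c'; split=> //.
have -> : a *: linext (fill c) s + f - (a + b) *: linext (fill c') s' =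
    a *: (linext (fill c) s - linext (fill c') s') + (f - b *: linext (fill c') s').
  by rewrite scalerDl scalerBr opprD addrACA.
apply: lspanD => //; apply: lspanZ; rewrite -ew.
by apply: same_word_congruent => //; rewrite e'.
Qed.

(** Composition-diamond lemma, by well-founded induction on the bound [w]. After merging, the
    coefficient of [w] in [h] is [a]: if nonzero, [w] itself is the reducible monomial; if zero, the
    bound drops. *)
Lemma lspan_reducible w h : compositions_trivial ->
  lspan (ctx_gen (le^~ w)) h -> h != 0 ->
  exists s c, S s /\ fill c (lead le s) \in msupp h.
Proof.
move=> triv; elim/(well_founded_ind (lt_wf le_mono)): w h => w IH h hw h0.
have low h' : lspan (ctx_gen (lt^~ w)) h' -> h' != 0 ->
    exists s c, S s /\ fill c (lead le s) \in msupp h'.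
  by case/lspan_bound => [->|[w' ltw' ?] ?]; [rewrite eqxx|apply: IH ltw' _ _ _].
have [/low/(_ h0) //|[a [s [c [Ss ew hlow]]]]] := lspan_le_top triv hw.
have [a0|a0] := eqVneq a 0.
  by apply: low => //; move: hlow; rewrite a0 scale0r subr0.
exists s, c; split=> //; rewrite ew.
have below : supp_in (lt^~ w) (h - a *: linext (fill c) s).
  by apply: supp_in_lspan hlow => u v; apply: (lt_trans le_mono).
(* Otherwise [w] would survive in the tail, whose monomials are all strictly below [w]. *)
have coef_s : (linext (fill c) s)@_w = 1.
  have := @linext_fill_tail c s Ss w; rewrite ew lt_irr.
  rewrite -mcoeff_neq0 mcoeffB mcoeffUU subr_eq0.
  by case: eqP => // _ /(_ isT).
have : w \notin msupp (h - a *: linext (fill c) s).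
  by apply/negP => /below; rewrite lt_irr.
by rewrite -mcoeff_eq0 mcoeffB mcoeffZ coef_s mulr1 subr_eq0 -mcoeff_neq0 => /eqP ->.
Qed.

(** * Termination and confluence of the rewriting system *)

Definition red_sys : rewsys k (bword Z) :=
  fun t r => exists s c,
    [/\ S s, t = fill c (lead le s) & r = << t >> - linext (fill c) s].
Local Notation step := (rewstep red_sys).
Local Notation star := (rewstar red_sys).

(** The rewritten monomial [t] is in the support of [f], hence satisfies [P]; the step subtracts a
    multiple of a generator with top word [t] and brings in only smaller monomials. *)
Lemma rewstep_lspan P f g : (forall u v, lt u v -> P v -> P u) ->
  supp_in P f -> step f g -> supp_in P g /\ lspan (ctx_gen P) (f - g).
Proof.
move=> Pd Pf [a [t [f1 [v [a0 tf1 [s [c [Ss et ev]]] ef eg]]]]].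
have Pt : P t.
  apply: Pf; rewrite -mcoeff_neq0 ef mcoeffD mcoeffUU.
  by move: tf1; rewrite -mcoeff_eq0 => /eqP ->; rewrite addr0.
split; last first.
  have -> : f - g = a *: linext (fill c) s.
    rewrite ef eg.
    have -> : << a *g t >> = a *: << t >> :> opalg k Z.
      by apply/malgP => u; rewrite mcoeffZ !mcoeffU mulrnAr mulr1.
    by rewrite opprD addrACA subrr addr0 -scalerBr ev subKr.
  by apply/lspanZ/lspan_gen; exists s, c; rewrite -et.
have Pf1 : supp_in P f1.
  have -> : f1 = f - << a *g t >> by rewrite ef addrAC subrr add0r.
  by apply: supp_inB => //; apply: supp_inU.
rewrite eg; apply: supp_inD => //; apply: supp_inZ; rewrite ev et => u.
by move=> /(linext_fill_tail Ss) /Pd; apply; rewrite -et.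
Qed.

Lemma rewstar_lspan P f g : (forall u v, lt u v -> P v -> P u) ->
  supp_in P f -> star f g -> supp_in P g /\ lspan (ctx_gen P) (f - g).
Proof.
move=> Pd Pf fg; elim: fg Pf => {f g} [f g fg|f|f g h _ IH1 _ IH2] Pf.
- exact: rewstep_lspan fg.
- by rewrite subrr; split=> //; apply: lspan0.
- have [Pg fg] := IH1 Pf; have [Ph gh] := IH2 Pg.
  by split=> //; rewrite -(subrKA g); apply: lspanD.
Qed.

Local Notation SN := (Acc (fun g f => step f g)).

(* Such an [f] is [a w + f'] with [f'] below [w]: a step either is a step of
   [f'], or replaces [w] and lands below [w]. *)
Lemma SN_supp_le w :
  (forall f, supp_in (lt^~ w) f -> SN f) -> forall f, supp_in (le^~ w) f -> SN f.
Proof.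
move=> SNlt.
suff SNadd a f : SN f -> supp_in (lt^~ w) f -> SN (f + << a *g w >>).
  move=> f fw; rewrite -(subrK << f@_w *g w >> f).
  have flt : supp_in (lt^~ w) (f - << f@_w *g w >>).
    move=> u uf; have : le u w.
      by apply: (supp_inB fw _ uf); apply: supp_inU; apply: wo_refl.
    rewrite /strict => ->; rewrite andbT; apply: contraTneq uf => ->.
    by rewrite -mcoeff_neq0 mcoeffB mcoeffUU subrr eqxx.
  exact: SNadd (SNlt _ flt) flt.
elim=> {}f _ IH fw; constructor => g.
have down u v : lt u v -> lt v w -> lt u w by apply: (lt_trans le_mono).
case=> b [t [f1 [v [b0 tf1 Rtv ef eg]]]].
have f1t : f1@_t = 0 by apply/eqP; rewrite mcoeff_eq0.
have [et|nt] := eqVneq t w.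
  have fw0 : f@_w = 0.
    by apply/eqP; rewrite mcoeff_eq0; apply/negP => /fw; rewrite lt_irr.
  have eab : a = b.
    have := congr1 (mcoeff w) ef.
    by rewrite !mcoeffD fw0 mcoeffUU -et mcoeffUU f1t addr0 add0r.
  have ef1 : f = f1 by apply: (addIr << a *g w >>); rewrite ef eab et addrC.
  apply: SNlt; rewrite eg; apply: supp_inD; last by rewrite -ef1.
  apply: supp_inZ; case: Rtv => s [c [Ss e ->]]; rewrite -et e.
  exact: linext_fill_tail.
(* Here [t] differs from [w], so removing the [w] term from both sides leaves a step of [f]. *)
pose f2 := f1 - << a *g w >>.
have stepf : step f (b *: v + f2).
  exists b, t, f2, v; split=> //.
    by rewrite -mcoeff_eq0 mcoeffB f1t mcoeffU [w == t]eq_sym (negbTE nt) mulr0n subrr.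
  by rewrite addrA -ef addrK.
have -> : g = (b *: v + f2) + << a *g w >> by rewrite eg -addrA subrK.
by apply: IH => //; have [] := rewstep_lspan down fw stepf.
Qed.

(** The leading monomial of [f] is below [w], and [SN_supp_le] applies there with the induction
    hypothesis. *)
Lemma SN_supp_lt w f : supp_in (lt^~ w) f -> SN f.
Proof.
elim/(well_founded_ind (lt_wf le_mono)): w f => w IH f fw.
have [->|/(leadP le_mono) [lf maxf]] := eqVneq f 0.
  (* No step starts from 0: the coefficient of [t] would be [a], which is nonzero. *)
  constructor => g [a [t [f1 [_ [a0 tf1 _ /(congr1 (mcoeff t)) e _]]]]].
  move: e a0; rewrite mcoeffD mcoeff0 mcoeffUU.
  by move: tf1; rewrite -mcoeff_eq0 => /eqP ->; rewrite addr0 => <-; rewrite eqxx.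
by apply: SN_supp_le maxf => g; apply/IH/fw.
Qed.

Lemma SN_all f : SN f.
Proof.
have [->|/(leadP le_mono) [_ maxf]] := eqVneq f 0.
  (* The bound [[::]] is arbitrary, since 0 has empty support. *)
  by apply: (@SN_supp_lt [::]); apply: supp_in0.
exact: SN_supp_le (@SN_supp_lt _) _ maxf.
Qed.

Lemma red_sys_terminating : terminating red_sys.
Proof.
case=> F Fstep; move: {2}(F _) (erefl (F 0%N)) => f.
elim: (SN_all f) (0%N) => {}f _ IH n Fn.
by apply: (IH (F n.+1)) (erefl _); rewrite -Fn.
Qed.

Lemma normal_form f : exists2 g, star f g & forall h, ~ step g h.
Proof.
elim: (SN_all f) => {}f _ IH.
have [[h fh]|nof] := pselect (exists h, step f h); last first.
  by exists f; [apply: rt_refl|move=> h fh; apply: nof; exists h].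
have [g hg ng] := IH h fh.
by exists g => //; apply: rt_trans hg; apply: rt_step.
Qed.

Lemma reducible_step f s c :
  S s -> fill c (lead le s) \in msupp f -> exists g, step f g.
Proof.
set t := fill _ _ => Ss tf; pose v := << t >> - linext (fill c) s.
pose f1 := f - << f@_t *g t >>.
exists (f@_t *: v + f1), (f@_t), t, f1, v; split=> //.
- by rewrite mcoeff_neq0.
- by rewrite -mcoeff_eq0 mcoeffB mcoeffUU subrr.
- by exists s, c.
- by rewrite addrC subrK.
Qed.

Lemma compositions_trivial_confluent :
  compositions_trivial -> confluent red_sys.
Proof.
move=> triv f g h fg fh.
have [g' gg' ng'] := normal_form g; have [h' hh' nh'] := normal_form h.
exists g'; split=> //; suff -> : g' = h' by [].
have span_to e : star f e -> lspan (ctx_gen (fun=> True)) (f - e).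
  by move=> fe; have [] := @rewstar_lspan (fun=> True) f e _ _ fe.
have : lspan (ctx_gen (fun=> True)) (g' - h').
  have -> : g' - h' = (f - h') - (f - g').
    by rewrite opprB [RHS]addrC subrKA.
  by apply: lspanB; apply: span_to; [apply: rt_trans hh'|apply: rt_trans gg'].
case/lspan_bound => [/eqP|[w _ gh]]; first by rewrite subr_eq0 => /eqP.
apply/eqP; rewrite -subr_eq0; apply: contrapT => /negP nz.
(* A reducible monomial of g' - h' occurs in [g'] or in [h'], which would then not be normal. *)
have [s [c [Ss /(fsubsetP (msuppB_le _ _))]]] := lspan_reducible triv gh nz.
rewrite in_fsetU => /orP [] /(reducible_step Ss) [e]; first exact: ng'.
exact: nh'.
Qed.

Lemma red_step c s : S s ->
  step << fill c (lead le s) >> (<< fill c (lead le s) >> - linext (fill c) s).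
Proof.
set t := fill _ _ => Ss; exists 1, t, 0, (<< t >> - linext (fill c) s).
by split; rewrite ?oner_neq0 ?msupp0 ?in_fset0 ?addr0 ?scale1r //; exists s, c.
Qed.

(** The word [w] rewrites by both rules to elements below [w], and these have a common reduct. Each
    path to it stays below [w], so it subtracts only generators with top word below [w]. *)
Lemma confluent_congruent c d f g : confluent red_sys ->
  S f -> S g -> fill c (lead le f) = fill d (lead le g) ->
  lspan (ctx_gen (lt^~ (fill c (lead le f))))
    (linext (fill c) f - linext (fill d) g).
Proof.
move=> conf Sf Sg cd.
have stepf := red_step c Sf; have stepg := red_step d Sg.
rewrite -cd in stepg; set w := fill c _ in stepf stepg *.
have [e [fe ge]] := conf _ _ _ (rt_step _ _ _ _ stepf) (rt_step _ _ _ _ stepg).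
have down u v : lt u v -> lt v w -> lt u w by apply: (lt_trans le_mono).
have [_ spanf] := rewstar_lspan down (linext_fill_tail (c := c) Sf) fe.
have gw : supp_in (lt^~ w) (<< w >> - linext (fill d) g).
  by rewrite /w cd; apply: linext_fill_tail.
have [_ spang] := rewstar_lspan down gw ge.
have := lspanB spang spanf.
by rewrite opprB addrA subrK opprB addrC addrA subrK.
Qed.

(** A composition is the difference of two generators with the same top word: in the contexts
    appending [u] and prepending [v] for an intersection, in the empty context and [q] for an
    inclusion. *)
Lemma confluent_compositions_trivial :
  confluent red_sys -> compositions_trivial.
Proof.
move=> conf f g w h Sf Sg; case.
  case=> u [v [wu wv _ _ ->]]; apply/trivial_modP.
  have := @confluent_congruent (ctx_here [::] u) (ctx_here v [::]) f g conf Sf Sg.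
  rewrite /= cats0 -wu -wv => /(_ erefl).
  rewrite malg_mulgU malg_mulUg; congr (lspan _ (_ - _)).
  by apply: eq_linext => x /=; rewrite cats0.
case=> q [wf wg ->]; apply/trivial_modP; have [c qc] := plug_fill q.
have := @confluent_congruent (ctx_here [::] [::]) c f g conf Sf Sg.
rewrite /= cats0 -qc -wf -wg => /(_ erefl); congr (lspan _ (_ - _)).
  rewrite [RHS](monalgE f) /linext.
  by apply: eq_bigr => u _; rewrite /= cats0.
exact/eq_linext/fsym.
Qed.

End Diamond.

(** * Orientation by leading monomials and the equivalence *)

Section Orientation.
Variables (k : fieldType) (Z : Type) (le : rel (bword Z)).
Hypothesis le_mono : monomial_order le.
Variable S : set (opalg k Z).
Hypothesis S_neq0 : forall s, S s -> s != 0.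

(** [remainder] and [monicize] divide by the same leading coefficient, and monicizing keeps the
    leading monomial, so the two sets of rules coincide. *)
Lemma oriented_lead_sys :
  oriented_sys S (@lead k Z le) = red_sys le [set monicize le s | s in S]%classic.
Proof.
have oriented_rule s q : S s ->
    pplug q (remainder (@lead k Z le) s) =
      << plug q (lead le s) >> - linext (plug q) (monicize le s).
  by move=> Ss; rewrite /pplug linextB linextU.
apply/funext => t; apply/funext => v; apply/propext; split.
  case=> s [q [Ss -> ->]]; have [c qc] := plug_fill q.
  exists (monicize le s), c; split; first by exists s.
    by rewrite (lead_monicize le_mono) ?qc // S_neq0.
  by rewrite oriented_rule // (eq_linext _ qc).
case=> _ [c [[s Ss <-] -> ->]]; rewrite (lead_monicize le_mono) ?S_neq0 //.
exists s, (ctx_star c); rewrite oriented_rule //; split=> //.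
  by rewrite plug_ctx_star.
by rewrite plug_ctx_star (eq_linext _ (plug_ctx_star c)).
Qed.

Theorem GS_basis_convergent :
  GS_basis le S <-> convergent_sys (oriented_sys S (@lead k Z le)).
Proof.
have S_monic s : [set monicize le s | s in S]%classic s -> lead_monic le s.
  by case=> s' Ss' <-; apply: monicize_monic => //; apply: S_neq0.
(* [GS_basis] unfolds to [compositions_trivial] for the monicized set. *)
rewrite oriented_lead_sys; split=> [triv|[_ conf]].
  split; first exact: red_sys_terminating.
  exact: compositions_trivial_confluent.
exact: confluent_compositions_trivial.
Qed.

End Orientation.

Lemma GS_on_convergent_on (k : fieldType) (X : Type) (Phi : set (opalg k X))
    (Z : Type) (le : rel (bword Z)) : monomial_order le ->
  GS_on Phi le <-> convergent_on Phi (@lead k Z le).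
Proof.
move=> le_mono; rewrite /GS_on GS_basis_convergent //; last by move=> s [].
by split=> [conv|[]] //; split=> // s [/(leadP le_mono) []].
Qed.

Theorem theorem3p16 (k : fieldType) (X : Type) (Phi : set (opalg k X)) :
  [/\ forall (Z : Type) (le : rel (bword Z)), monomial_order le ->
        (GS_on Phi le <-> convergent_on Phi (@lead k Z le)),
      GS Phi -> convergent Phi &
      pot_GS Phi -> pot_convergent Phi].
Proof.
split=> [Z le|gs Z|gs Z]; first exact: GS_on_convergent_on.
  have [le [le_mono gsZ]] := gs Z.
  by exists (lead le); apply/GS_on_convergent_on.
have [le [le_mono [Phi' [sPhi eqId /(GS_on_convergent_on Phi' le_mono) conv]]]] := gs Z.
(* The one function [lead le] orients the instances of both [Phi] and [Phi'], so the second
   orientation extends the first. *)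
exists (lead le); split; first by move=> s [/(leadP le_mono) []].
by exists Phi', (lead le).
Qed.
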